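(* Let $G$ be a finite group and $N\trianglelefteq G$. The map $\mathrm{dBInf}^G_{G/N}:B(G/N,G/N)^\times\to B(G,G)^\times$ restricts to a group homomorphism \[\mathrm{dBInf}^G_{G/N}:B_\circ(G/N,G/N)\to B_\circ(G,G).\]
   Context: For finite groups $G,H$, a $(G,H)$-biset is a set with commuting left $G$-action and right $H$-action. $B(G,H)$ denotes the Grothendieck group of isomorphism classes of finite $(G,H)$-bisets with respect to disjoint union. For a $(G,H)$-biset $X$ and an $(H,K)$-biset $Y$, $X\times_H Y$ is the set of $H$-orbits of $X\times Y$ under $h\cdot(x,y)=(xh^{-1},hy)$, with its natural $(G,K)$-biset structure; this induces associative bilinear maps $\circ:B(G,H)\times B(H,K)\to B(G,K)$. The double Burnside ring of $G$ is $B(G,G)$ with multiplication $\circ$; its identity is $\mathrm{Id}_G=[G]$ ($G$ acting on itself by left and right multiplication). The opposite of a $(G,H)$-biset $X$ is the $(H,G)$-biset $X^\circ$ with underlying set $X$ and action $h\cdot x\cdot g=g^{-1}xh^{-1}$; this induces an additive map $(-)^\circ:B(G,H)\to B(H,G)$, which for $G=H$ is an anti-involution of the ring $B(G,G)$. The group of orthogonal units is $B_\circ(G,G)=\{u\in B(G,G)^\times : uu^\circ=u^\circ u=\mathrm{Id}_G\}$. For $N\trianglelefteq G$, $\mathrm{Inf}_{G/N}^G\in B(G,G/N)$ is the class of the set $G/N$ with its natural $(G,G/N)$-action, and $\mathrm{Def}_{G/N}^G\in B(G/N,G)$ is the class of $G/N$ with its natural $(G/N,G)$-action. The group homomorphism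 $\mathrm{dBInf}_{G/N}^G:B(G/N,G/N)^\times\to B(G,G)^\times$ is $u\mapsto \mathrm{Id}_G+\mathrm{Inf}_{G/N}^G\circ(u-\mathrm{Id}_{G/N})\circ\mathrm{Def}_{G/N}^G$. *)

(* Defs.v *)
From HB Require Import structures.
From mathcomp Require Import all_boot all_order all_fingroup all_algebra.
From mathcomp Require Import boolp.

Set Implicit Arguments.
Unset Strict Implicit.
Unset Printing Implicit Defensive.

Import generic_quotient GRing.Theory.
Local Open Scope ring_scope.
Local Open Scope quotient_scope.

Lemma bij_inj_surj (S T : finType) (f : S -> T) :
  injective f -> (forall y, exists x, f x = y) -> bijective f.
Proof.
move=> fI fS; apply: (inj_card_bij fI).
rewrite -(card_codom fI); apply: subset_leq_card; apply/subsetP => y _.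
by have [x <-] := fS y; apply: codom_f.
Qed.

Record biset_on (G H : finGroupType) (T : Type) := BisetOn {
  lact : G -> T -> T;
  ract : T -> H -> T;
  lact1 : forall x, lact 1%g x = x;
  lactM : forall g g' x, lact (g * g')%g x = lact g (lact g' x);
  ract1 : forall x, ract x 1%g = x;
  ractM : forall x h h', ract x (h * h')%g = ract (ract x h) h';
  lractA : forall g x h, ract (lact g x) h = lact g (ract x h)
}.

Record biset (G H : finGroupType) := Biset {
  bcar :> finType;
  bact :> biset_on G H bcar
}.

Definition biset_iso (G H : finGroupType) (X Y : biset G H) : Prop :=
  exists f : X -> Y, [/\ bijective f,
    forall g x, f (lact X g x) = lact Y g (f x) &
    forall x h, f (ract X x h) = ract Y (f x) h].

Section Iso.
Variables G H : finGroupType.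
Implicit Types X Y Z : biset G H.

Lemma biset_iso_refl X : biset_iso X X.
Proof. by exists id; split=> //; exists id. Qed.

Lemma biset_iso_sym X Y : biset_iso X Y -> biset_iso Y X.
Proof.
move=> [f [[f' fK f'K] fl fr]]; exists f'; split; first by exists f.
  by move=> g y; apply: (can_inj fK); rewrite fl !f'K.
by move=> y h; apply: (can_inj fK); rewrite fr !f'K.
Qed.

Lemma biset_iso_trans Y X Z :
  biset_iso X Y -> biset_iso Y Z -> biset_iso X Z.
Proof.
move=> [f [fB fl fr]] [f' [f'B f'l f'r]]; exists (f' \o f).
split; first exact: bij_comp.
  by move=> g x /=; rewrite fl f'l.
by move=> x h /=; rewrite fr f'r.
Qed.

Lemma biset_isoI X Y (f : X -> Y) :
    injective f -> (forall y, exists x, f x = y) ->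
    (forall g x, f (lact X g x) = lact Y g (f x)) ->
    (forall x h, f (ract X x h) = ract Y (f x) h) ->
  biset_iso X Y.
Proof. by move=> fI fS fl fr; exists f; split=> //; apply: bij_inj_surj. Qed.

Lemma lactK X g : cancel (lact X g) (lact X g^-1%g).
Proof. by move=> x; rewrite -lactM mulVg lact1. Qed.

Lemma lactKV X g : cancel (lact X g^-1%g) (lact X g).
Proof. by move=> x; rewrite -lactM mulgV lact1. Qed.

Lemma ractK X h x : ract X (ract X x h) h^-1%g = x.
Proof. by rewrite -ractM mulgV ract1. Qed.

Lemma ractKV X h x : ract X (ract X x h^-1%g) h = x.
Proof. by rewrite -ractM mulVg ract1. Qed.

End Iso.

Section DisjointUnion.
Variables G H : finGroupType.

Definition bempty_on : biset_on G H void.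
Proof. by exists (fun _ x => x) (fun x _ => x). Defined.
Definition bempty : biset G H := Biset bempty_on.

Definition bsum_on (X Y : biset G H) : biset_on G H (X + Y)%type.
Proof.
exists (fun g z => match z with inl x => inl (lact X g x)
                              | inr y => inr (lact Y g y) end)
       (fun z h => match z with inl x => inl (ract X x h)
                              | inr y => inr (ract Y y h) end).
- by case=> x; rewrite lact1.
- by move=> g g' [] x; rewrite lactM.
- by case=> x; rewrite ract1.
- by case=> x h h'; rewrite ractM.
- by move=> g [] x h; rewrite lractA.
Defined.
Definition bsum (X Y : biset G H) : biset G H := Biset (bsum_on X Y).

Implicit Types X Y Z : biset G H.

Lemma bsum_iso X X' Y Y' :
  biset_iso X X' -> biset_iso Y Y' -> biset_iso (bsum X Y) (bsum X' Y').
Proof.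
move=> [f [[f' fK f'K] fl fr]] [e [[e' eK e'K] el er]].
exists (fun z : bsum X Y => match z with inl x => inl (f x)
                          | inr y => inr (e y) end : bsum X' Y').
split.
- exists (fun z => match z with inl x => inl (f' x) | inr y => inr (e' y) end).
    by case=> x /=; rewrite ?fK ?eK.
  by case=> x /=; rewrite ?f'K ?e'K.
- by move=> g [] x /=; rewrite ?fl ?el.
- by case=> x h /=; rewrite ?fr ?er.
Qed.

Lemma bsumC X Y : biset_iso (bsum X Y) (bsum Y X).
Proof.
exists (fun z : bsum X Y => match z with inl x => inr x
                          | inr y => inl y end : bsum Y X).
split; [|by move=> g []|by case].
by exists (fun z => match z with inl x => inr x | inr y => inl y end); case.
Qed.

Lemma bsumA X Y Z : biset_iso (bsum X (bsum Y Z)) (bsum (bsum X Y) Z).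
Proof.
exists (fun w : bsum X (bsum Y Z) => match w with
   inl x => inl (inl x) | inr (inl y) => inl (inr y)
   | inr (inr z) => inr z end : bsum (bsum X Y) Z).
split; [|by move=> g [|[]]|by case=> [|[]]].
by exists (fun w => match w with inl (inl x) => inl x
   | inl (inr y) => inr (inl y) | inr z => inr (inr z) end);
  [case=> [|[]]|case=> [[]|]].
Qed.

Lemma bsum0 X : biset_iso (bsum bempty X) X.
Proof.
exists (fun z : bsum bempty X => match z with inl x => match x with end
  | inr y => y end).
split; [|by move=> g []|by case].
by exists inr => // -[].
Qed.

End DisjointUnion.

Section Tensor.
Variables G H K : finGroupType.
Variables (X : biset G H) (Y : biset H K).

Definition tens_orbit (p : X * Y) : {set X * Y} :=
  [set (ract X p.1 h^-1%g, lact Y h p.2) | h : H].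

Definition tens_car := {O : {set X * Y} | O \in codom tens_orbit}.
HB.instance Definition _ := Finite.on tens_car.

Definition tcl (x : X) (y : Y) : tens_car :=
  exist _ (tens_orbit (x, y)) (codom_f tens_orbit (x, y)).
Definition trep (O : tens_car) : X * Y := iinv (valP O).

Lemma trepK O : tcl (trep O).1 (trep O).2 = O.
Proof. by apply: val_inj; rewrite /= -surjective_pairing f_iinv. Qed.

Lemma tcl_surj O : exists x y, O = tcl x y.
Proof. by exists (trep O).1, (trep O).2; rewrite trepK. Qed.

Lemma tclP x y x' y' :
  tcl x y = tcl x' y' <->
  exists h : H, x' = ract X x h^-1%g /\ y' = lact Y h y.
Proof.
split=> [/(congr1 val) /= /setP/(_ (x', y'))|[h [-> ->]]].
  have -> : (x', y') \in tens_orbit (x', y').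
    by apply/imsetP; exists 1%g; rewrite //= invg1 ract1 lact1.
  by case/imsetP => h _ [-> ->]; exists h.
apply: val_inj; apply/setP => z /=; apply/imsetP/imsetP => -[k _ ->] /=.
  exists (k * h^-1)%g => //.
  by rewrite invMg invgK -ractM mulKg -!lactM mulgVK.
by exists (k * h)%g => //; rewrite invMg -ractM -lactM.
Qed.

Lemma tcl_mid x h y : tcl (ract X x h) y = tcl x (lact Y h y).
Proof. by apply/tclP; exists h; rewrite ractK. Qed.

Lemma trep_tcl x y : exists h : H,
  trep (tcl x y) = (ract X x h^-1%g, lact Y h y).
Proof.
have /esym/tclP[h [e1 e2]] := trepK (tcl x y).
by exists h; rewrite [LHS]surjective_pairing e1 e2.
Qed.

Let tlact g O := tcl (lact X g (trep O).1) (trep O).2.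
Let tract O k := tcl (trep O).1 (ract Y (trep O).2 k).

Lemma tlactE g x y : tlact g (tcl x y) = tcl (lact X g x) y.
Proof.
rewrite /tlact; have [h -> /=] := trep_tcl x y.
by apply/esym/tclP; exists h; rewrite lractA.
Qed.

Lemma tractE x y k : tract (tcl x y) k = tcl x (ract Y y k).
Proof.
rewrite /tract; have [h -> /=] := trep_tcl x y.
by apply/esym/tclP; exists h; rewrite lractA.
Qed.

Definition tens_on : biset_on G K tens_car.
Proof.
exists tlact tract.
- by move=> O; have [x [y ->]] := tcl_surj O; rewrite tlactE lact1.
- by move=> g g' O; have [x [y ->]] := tcl_surj O; rewrite !tlactE lactM.
- by move=> O; have [x [y ->]] := tcl_surj O; rewrite tractE ract1.
- by move=> O k k'; have [x [y ->]] := tcl_surj O; rewrite !tractE ractM.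
- move=> g O k; have [x [y ->]] := tcl_surj O.
  by rewrite !(tlactE, tractE).
Defined.

Definition tens : biset G K := Biset tens_on.

Lemma lact_tcl g x y : lact tens g (tcl x y) = tcl (lact X g x) y.
Proof. exact: tlactE. Qed.

Lemma ract_tcl x y k : ract tens (tcl x y) k = tcl x (ract Y y k).
Proof. exact: tractE. Qed.

Lemma tens_isoI (Z : biset G K) (F : X -> Y -> Z) :
    (forall x h y, F (ract X x h) y = F x (lact Y h y)) ->
    (forall x y x' y', F x y = F x' y' -> tcl x y = tcl x' y') ->
    (forall z, exists x y, F x y = z) ->
    (forall g x y, F (lact X g x) y = lact Z g (F x y)) ->
    (forall x y k, F x (ract Y y k) = ract Z (F x y) k) ->
  biset_iso tens Z.
Proof.
move=> Fm FI FS Fl Fr; pose f (O : tens) := F (trep O).1 (trep O).2.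
have fE x y : f (tcl x y) = F x y.
  by rewrite /f; have [h -> /=] := trep_tcl x y; rewrite -Fm ractKV.
apply: (@biset_isoI _ _ tens Z f).
- move=> O O'; have [x [y ->]] := tcl_surj O; have [x' [y' ->]] := tcl_surj O'.
  by rewrite !fE => /FI.
- by move=> z; have [x [y <-]] := FS z; exists (tcl x y).
- by move=> g O; have [x [y ->]] := tcl_surj O; rewrite lact_tcl !fE Fl.
- by move=> O k; have [x [y ->]] := tcl_surj O; rewrite ract_tcl !fE Fr.
Qed.

End Tensor.

Arguments tclP {G H K X Y x y x' y'}.

Section TensorTheory.
Variables G H K L : finGroupType.

Lemma tens_iso (X X' : biset G H) (Y Y' : biset H K) :
  biset_iso X X' -> biset_iso Y Y' -> biset_iso (tens X Y) (tens X' Y').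
Proof.
move=> [f [fB fl fr]] [e [eB el er]].
have [f' fK f'K] := fB; have [e' eK e'K] := eB.
apply: (@tens_isoI _ _ _ X Y (tens X' Y')
  (fun x y => tcl (f x) (e y))).
- by move=> x h y; rewrite fr el tcl_mid.
- move=> x y x' y' /tclP[h []]; rewrite -fr -el => /(bij_inj fB) -> .
  by move/(bij_inj eB) ->; apply/tclP; exists h.
- move=> O; have [x [y ->]] := tcl_surj O.
  by exists (f' x), (e' y); rewrite f'K e'K.
- by move=> g x y; rewrite fl lact_tcl.
- by move=> x y k; rewrite er ract_tcl.
Qed.

Lemma tensA (X : biset G H) (Y : biset H K) (Z : biset K L) :
  biset_iso (tens X (tens Y Z)) (tens (tens X Y) Z).
Proof.
apply: biset_iso_sym; pose F (O : tens X Y) z : tens X (tens Y Z) :=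
  tcl (trep O).1 (tcl (trep O).2 z : tens Y Z).
have FE x y z : F (tcl x y) z = tcl x (tcl y z : tens Y Z).
  rewrite /F; have [h -> /=] := trep_tcl x y.
  by rewrite tcl_mid lact_tcl lactK.
apply: (@tens_isoI _ _ _ (tens X Y) Z _ F).
- move=> O k z; have [x [y ->]] := tcl_surj O.
  by rewrite ract_tcl !FE tcl_mid.
- move=> O z O' z'.
  have [x [y ->]] := tcl_surj O; have [x' [y' ->]] := tcl_surj O'.
  rewrite !FE => /tclP[h [-> ]]; rewrite lact_tcl => /esym/tclP[k [-> ->]].
  apply: (tclP.2 _); exists k; split=> //.
  by rewrite ract_tcl tcl_mid -lractA lactK.
- move=> O; have [x [O' ->]] := tcl_surj O; have [y [z ->]] := tcl_surj O'.
  by exists (tcl x y), z; rewrite FE.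
- by move=> g O z; have [x [y ->]] := tcl_surj O; rewrite !(lact_tcl, FE).
- by move=> O z k; have [x [y ->]] := tcl_surj O; rewrite !FE !ract_tcl.
Qed.

Lemma tensDl (X X' : biset G H) (Y : biset H K) :
  biset_iso (tens (bsum X X') Y) (bsum (tens X Y) (tens X' Y)).
Proof.
apply: (@tens_isoI _ _ _ (bsum X X') Y (bsum (tens X Y) (tens X' Y))
  (fun z y => match z with inl x => inl (tcl x y) | inr x => inr (tcl x y) end)).
- by case=> x h y /=; rewrite tcl_mid.
- by case=> x y [] x' y' //= -[e];
    (have /tclP[h [-> ->]] : tcl x y = tcl x' y' by apply: val_inj);
    apply/tclP; exists h.
- case=> O; have [x [y ->]] := tcl_surj O; first by exists (inl x), y.
  by exists (inr x), y.
- by move=> g [] x y; rewrite /= -lact_tcl.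
- by case=> x y k; rewrite /= -ract_tcl.
Qed.

Lemma tensDr (X : biset G H) (Y Y' : biset H K) :
  biset_iso (tens X (bsum Y Y')) (bsum (tens X Y) (tens X Y')).
Proof.
apply: (@tens_isoI _ _ _ X (bsum Y Y') (bsum (tens X Y) (tens X Y'))
  (fun x z => match z with inl y => inl (tcl x y) | inr y => inr (tcl x y) end)).
- by move=> x h [] y /=; rewrite tcl_mid.
- by move=> x [] y x' [] y' //= -[e];
    (have /tclP[h [-> ->]] : tcl x y = tcl x' y' by apply: val_inj);
    apply/tclP; exists h.
- case=> O; have [x [y ->]] := tcl_surj O; first by exists x, (inl y).
  by exists x, (inr y).
- by move=> g x [] y; rewrite /= -lact_tcl.
- by move=> x [] y k; rewrite /= -ract_tcl.
Qed.

End TensorTheory.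

Definition bid_on (G : finGroupType) : biset_on G G G.
Proof.
exists (fun g x => g * x)%g (fun x h => x * h)%g.
- exact: mul1g.
- by move=> *; rewrite mulgA.
- exact: mulg1.
- by move=> *; rewrite mulgA.
- by move=> *; rewrite mulgA.
Defined.
Definition bid (G : finGroupType) : biset G G := Biset (bid_on G).

Definition bop_on (G H : finGroupType) (X : biset G H) : biset_on H G X.
Proof.
exists (fun h x => ract X x h^-1%g) (fun x g => lact X g^-1%g x).
- by move=> x; rewrite invg1 ract1.
- by move=> h h' x; rewrite invMg ractM.
- by move=> x; rewrite invg1 lact1.
- by move=> x g g'; rewrite invMg lactM.
- by move=> h x g; rewrite lractA.
Defined.
Definition bop (G H : finGroupType) (X : biset G H) : biset H G :=
  Biset (bop_on X).

Section IdOpTheory.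
Variables G H K : finGroupType.

Lemma tens1l (X : biset G H) : biset_iso (tens (bid G) X) X.
Proof.
apply: (@tens_isoI _ _ _ (bid G) X X (lact X)).
- by move=> x h y; rewrite /= lactM.
- move=> g x g' x' e; apply/tclP; exists (g'^-1 * g)%g => /=; split.
    by rewrite invMg invgK mulKVg.
  by rewrite lactM e lactK.
- by move=> x; exists 1%g, x; rewrite lact1.
- by move=> g g' x; rewrite /= lactM.
- by move=> g x k; rewrite lractA.
Qed.

Lemma tens1r (X : biset G H) : biset_iso (tens X (bid H)) X.
Proof.
apply: (@tens_isoI _ _ _ X (bid H) X (ract X)).
- by move=> x h y; rewrite /= ractM.
- move=> x h x' h' e; apply/tclP; exists (h' * h^-1)%g => /=; split.
    by rewrite invMg invgK ractM e ractK.
  by rewrite mulgVK.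
- by move=> x; exists x, 1%g; rewrite ract1.
- by move=> g x h; rewrite lractA.
- by move=> x h k; rewrite /= ractM.
Qed.

Lemma bop_iso (X Y : biset G H) : biset_iso X Y -> biset_iso (bop X) (bop Y).
Proof.
move=> [f [fB fl fr]]; exists f; split=> // [g x|x h] /=.
  by rewrite fr.
by rewrite fl.
Qed.

Lemma bopD (X Y : biset G H) :
  biset_iso (bop (bsum X Y)) (bsum (bop X) (bop Y)).
Proof. by exists id; split=> //; exists id. Qed.

Lemma bopK (X : biset G H) : biset_iso (bop (bop X)) X.
Proof.
by exists id; split=> [|g x|x h] /=; rewrite ?invgK //; exists id.
Qed.

Lemma bop1 : biset_iso (bop (bid G)) (bid G).
Proof.
exists (fun x : G => x^-1)%g; split=> [|g x|x h] /=.
- by exists (fun x : G => x^-1)%g => x; rewrite invgK.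
- by rewrite invMg invgK.
- by rewrite invMg invgK.
Qed.

Lemma bop_tens (X : biset G H) (Y : biset H K) :
  biset_iso (bop (tens X Y)) (tens (bop Y) (bop X)).
Proof.
apply: biset_iso_sym.
apply: (@tens_isoI _ _ _ (bop Y) (bop X) (bop (tens X Y))
  (fun (y : Y) (x : X) => tcl x y)).
- by move=> y h x; rewrite /= tcl_mid.
- move=> y x y' x' /tclP[h [-> ->]]; apply/tclP; exists h.
  by rewrite /= invgK.
- by move=> O; have [x [y ->]] := tcl_surj O; exists y, x.
- by move=> k y x /=; rewrite -ract_tcl.
- by move=> y x g /=; rewrite -lact_tcl.
Qed.

End IdOpTheory.

(* Every finite biset is isomorphic to one carried by some 'I_n; taking these
   as representatives keeps the set of isomorphism classes in the universe of
   choiceType, where a record over all finite types does not fit. *)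
Record obiset (G H : finGroupType) := OBiset {
  ocard : nat;
  oact : biset_on G H 'I_ocard
}.
HB.instance Definition _ (G H : finGroupType) := gen_eqMixin (obiset G H).
HB.instance Definition _ (G H : finGroupType) := gen_choiceMixin (obiset G H).

Section Classes.
Variables G H : finGroupType.
Implicit Types X Y Z : biset G H.

Definition odecode (x : obiset G H) : biset G H := Biset (oact x).

Definition oencode_on X : biset_on G H 'I_#|X|.
Proof.
exists (fun g i => enum_rank (lact X g (enum_val i)))
       (fun i h => enum_rank (ract X (enum_val i) h)).
- by move=> i; rewrite lact1 enum_valK.
- by move=> g g' i; rewrite enum_rankK lactM.
- by move=> i; rewrite ract1 enum_valK.
- by move=> i h h'; rewrite enum_rankK ractM.
- by move=> g i h; rewrite !enum_rankK lractA.
Defined.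
Definition oencode X : obiset G H := OBiset (oencode_on X).

Lemma oencodeK X : biset_iso (odecode (oencode X)) X.
Proof.
exists (fun i : 'I_#|X| => enum_val i); split=> [|g i|i h] /=;
  rewrite ?enum_rankK //.
by exists enum_rank; [apply: enum_valK|apply: enum_rankK].
Qed.

Definition obiset_iso : rel (obiset G H) :=
  fun x y => `[< biset_iso (odecode x) (odecode y) >].

Lemma obiset_iso_equiv : equiv_class_of obiset_iso.
Proof.
split=> [x|x y|y x z]; first by apply/asboolP; apply: biset_iso_refl.
  by apply/asboolP/asboolP; apply: biset_iso_sym.
by move=> /asboolP xy /asboolP yz; apply/asboolP; apply: biset_iso_trans yz.
Qed.
Canonical obiset_iso_equiv_rel := EquivRelPack obiset_iso_equiv.

Definition biset_class := {eq_quot obiset_iso}.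
HB.instance Definition _ := Choice.on biset_class.

Definition bcls X : biset_class := \pi_biset_class (oencode X).
Definition brep (c : biset_class) : biset G H := odecode (repr c).

Lemma bclsP X Y : bcls X = bcls Y <-> biset_iso X Y.
Proof.
split=> [/eqmodP/asboolP XY|XY].
  apply: (biset_iso_trans (biset_iso_sym (oencodeK X))).
  exact: biset_iso_trans (oencodeK Y).
apply/eqmodP/asboolP; apply: (biset_iso_trans (oencodeK X)).
exact: biset_iso_trans XY (biset_iso_sym (oencodeK Y)).
Qed.

Lemma brepK c : bcls (brep c) = c.
Proof.
rewrite -[RHS]reprK; apply/eqmodP/asboolP.
exact: oencodeK.
Qed.

Lemma brep_cls X : biset_iso (brep (bcls X)) X.
Proof. by apply/bclsP; rewrite brepK. Qed.

Lemma bcls_ind (P : biset_class -> Prop) :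
  (forall X, P (bcls X)) -> forall c, P c.
Proof. by move=> PX c; rewrite -(brepK c). Qed.

Definition bcls_add c d := bcls (bsum (brep c) (brep d)).

Lemma bcls_addE X Y : bcls_add (bcls X) (bcls Y) = bcls (bsum X Y).
Proof. by apply/bclsP; apply: bsum_iso; apply: brep_cls. Qed.

Fact bcls_addA : associative bcls_add.
Proof.
elim/bcls_ind=> X; elim/bcls_ind=> Y; elim/bcls_ind=> Z.
by rewrite !bcls_addE; apply/bclsP; apply: bsumA.
Qed.

Fact bcls_addC : commutative bcls_add.
Proof.
elim/bcls_ind=> X; elim/bcls_ind=> Y.
by rewrite !bcls_addE; apply/bclsP; apply: bsumC.
Qed.

Fact bcls_add0 : left_id (bcls (bempty G H)) bcls_add.
Proof.
by elim/bcls_ind=> X; rewrite bcls_addE; apply/bclsP; apply: bsum0.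
Qed.

HB.instance Definition _ :=
  GRing.isNmodule.Build biset_class bcls_addA bcls_addC bcls_add0.

Lemma bclsD X Y : bcls (bsum X Y) = bcls X + bcls Y.
Proof. by rewrite -bcls_addE. Qed.

End Classes.

Section Grothendieck.
Variable M : nmodType.
Implicit Types (p q r : M * M) (a b c d : M).

(* The pair (a, b) stands for the formal difference a - b; the extra z is
   needed because M is not assumed cancellative. *)
Definition groth_eq : rel (M * M) :=
  fun p q => `[< exists z, p.1 + q.2 + z = q.1 + p.2 + z >].

Lemma groth_eq_equiv : equiv_class_of groth_eq.
Proof.
split=> [p|p q|q p r].
- by apply/asboolP; exists 0.
- by apply/asboolP/asboolP => -[z e]; exists z.
- move=> /asboolP[z e] /asboolP[z' e']; apply/asboolP.
  exists (q.1 + q.2 + z + z').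
  rewrite [LHS](AC (2*4) ((1*4*5)*(3*2*6))) /= e e'.
  by rewrite [RHS](AC (2*4) ((3*2*5)*(1*4*6))).
Qed.
Canonical groth_equiv_rel := EquivRelPack groth_eq_equiv.

Definition groth := {eq_quot groth_eq}.
HB.instance Definition _ := Choice.on groth.

Definition gdiff a b : groth := \pi_groth (a, b).

Lemma gdiffP a b c d :
  gdiff a b = gdiff c d <-> exists z, a + d + z = c + b + z.
Proof.
by split=> [/eqmodP/asboolP|e]; last apply/eqmodP/asboolP.
Qed.

Lemma greprK (x : groth) : gdiff (repr x).1 (repr x).2 = x.
Proof. by rewrite /gdiff -surjective_pairing reprK. Qed.

Lemma gdiff_repr a b : exists z,
  (repr (gdiff a b)).1 + b + z = a + (repr (gdiff a b)).2 + z.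
Proof. by apply/gdiffP; rewrite greprK. Qed.

Lemma gdiff_ind (P : groth -> Prop) :
  (forall a b, P (gdiff a b)) -> forall x, P x.
Proof. by move=> Pd x; rewrite -(greprK x). Qed.

Definition gadd (x y : groth) :=
  gdiff ((repr x).1 + (repr y).1) ((repr x).2 + (repr y).2).
Definition gopp (x : groth) := gdiff (repr x).2 (repr x).1.

Lemma gaddE a b c d : gadd (gdiff a b) (gdiff c d) = gdiff (a + c) (b + d).
Proof.
have [z e] := gdiff_repr a b; have [z' e'] := gdiff_repr c d.
apply/gdiffP; exists (z + z').
rewrite [LHS](AC (2*2*2) ((1*3*5)*(2*4*6))) /= e e'.
by rewrite [RHS](AC (2*2*2) ((1*3*5)*(2*4*6))).
Qed.

Lemma goppE a b : gopp (gdiff a b) = gdiff b a.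
Proof.
have [z e] := gdiff_repr a b; apply/gdiffP; exists z.
by rewrite addrC [RHS]addrC ![_ + (_ + _)]addrC [in LHS](addrC _ a)
           [in RHS](addrC b).
Qed.

Fact gaddA : associative gadd.
Proof.
elim/gdiff_ind=> a b; elim/gdiff_ind=> c d; elim/gdiff_ind=> e f.
by rewrite !gaddE !addrA.
Qed.

Fact gaddC : commutative gadd.
Proof.
elim/gdiff_ind=> a b; elim/gdiff_ind=> c d.
by rewrite !gaddE [a + c]addrC [b + d]addrC.
Qed.

Fact gadd0 : left_id (gdiff 0 0) gadd.
Proof. by elim/gdiff_ind=> a b; rewrite gaddE !add0r. Qed.

Fact gaddN : left_inverse (gdiff 0 0) gopp gadd.
Proof.
elim/gdiff_ind=> a b; rewrite goppE gaddE.
by apply/gdiffP; exists 0; rewrite !addr0 add0r addrC.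
Qed.

HB.instance Definition _ := GRing.isZmodule.Build groth gaddA gaddC gadd0 gaddN.

Definition gin a : groth := gdiff a 0.

Lemma ginD a b : gin (a + b) = gin a + gin b.
Proof. by rewrite [RHS]gaddE addr0. Qed.

Lemma gdiffE a b : gdiff a b = gin a - gin b.
Proof. by rewrite [- _]goppE [RHS]gaddE addr0 add0r. Qed.

Lemma gin_ind (P : groth -> Prop) :
  (forall a, P (gin a)) -> (forall x y, P x -> P y -> P (x - y)) ->
  forall x, P x.
Proof. by move=> Pi PB; elim/gdiff_ind=> a b; rewrite gdiffE; apply: PB. Qed.

Lemma ginP a b : gin a = gin b <-> exists z, a + z = b + z.
Proof.
split=> [/gdiffP[z]|[z e]]; first by rewrite !addr0; exists z.
by apply/gdiffP; exists z; rewrite !addr0.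
Qed.

Section Extension.
Variables (A : zmodType) (f : M -> A).

(* For additive f this is the unique homomorphism groth M -> A extending f;
   the value does not depend on the representative repr x. *)
Definition glift (x : groth) : A := let: (a, b) := repr x in f a - f b.

Hypothesis fD : {morph f : a b / a + b}.

Lemma glift_diff a b : glift (gdiff a b) = f a - f b.
Proof.
rewrite /glift; have [z /(congr1 f)] := gdiff_repr a b.
case: (repr _) => c d; rewrite !fD => /addIr /= e.
by apply/eqP; rewrite subr_eq addrAC -subr_eq opprK e.
Qed.

Lemma glift_in a : glift (gin a) = f a.
Proof.
have f0 : f 0 = 0 by apply: (@addrI _ (f 0)); rewrite -fD !addr0.
by rewrite glift_diff f0 subr0.
Qed.

Lemma gliftB : {morph glift : x y / x - y}.
Proof.
elim/gdiff_ind=> a b; elim/gdiff_ind=> c d.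
rewrite [- gdiff c d]goppE [gdiff a b + _]gaddE !glift_diff !fD opprD opprB.
by rewrite [LHS](AC (2*2) ((1*3)*(2*4))) /= [f d - _]addrC.
Qed.

End Extension.

End Grothendieck.

Definition burnside (G H : finGroupType) := groth (biset_class G H).
HB.instance Definition _ (G H : finGroupType) :=
  GRing.Zmodule.on (burnside G H).

Definition bmk (G H : finGroupType) (X : biset G H) : burnside G H :=
  gin (bcls X).

Section Burnside.
Variables G H K : finGroupType.

Lemma bmkD (X Y : biset G H) : bmk (bsum X Y) = bmk X + bmk Y.
Proof. by rewrite /bmk bclsD [LHS]ginD. Qed.

Lemma bmk_iso (X Y : biset G H) : biset_iso X Y -> bmk X = bmk Y.
Proof. by rewrite /bmk => /bclsP ->. Qed.

Lemma bmk_ind (P : burnside G H -> Prop) :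
  (forall X, P (bmk X)) -> (forall u v, P u -> P v -> P (u - v)) ->
  forall u, P u.
Proof.
by move=> PX PB; elim/gin_ind=> //; elim/bcls_ind=> X; apply: PX.
Qed.

(* Operations on bisets are transported to isomorphism classes by computing on
   representatives (independence: tens_classE, bop_classE). *)
Definition tens_class (c : biset_class G H) (d : biset_class H K) :
  biset_class G K := bcls (tens (brep c) (brep d)).

Definition bcomp (u : burnside G H) (v : burnside H K) : burnside G K :=
  glift (fun c => glift (fun d => gin (tens_class c d)) v) u.

Lemma tens_classE (X : biset G H) (Y : biset H K) :
  tens_class (bcls X) (bcls Y) = bcls (tens X Y).
Proof. by apply/bclsP; apply: tens_iso; apply: brep_cls. Qed.

Lemma tens_classDl d : {morph tens_class^~ d : c c' / c + c'}.
Proof.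
elim/bcls_ind: d => Y; elim/bcls_ind=> X; elim/bcls_ind=> X'.
by rewrite -bclsD !tens_classE -bclsD; apply/bclsP/tensDl.
Qed.

Lemma tens_classDr c : {morph tens_class c : d d' / d + d'}.
Proof.
elim/bcls_ind: c => X; elim/bcls_ind=> Y; elim/bcls_ind=> Y'.
by rewrite -bclsD !tens_classE -bclsD; apply/bclsP/tensDr.
Qed.

Let tens_inr c : {morph (fun d => gin (tens_class c d)) : d d' / d + d'}.
Proof. by move=> d d'; rewrite tens_classDr ginD. Qed.

Let tens_inl v : {morph (fun c => glift (fun d => gin (tens_class c d)) v)
  : c c' / c + c'}.
Proof.
move=> c c'; elim/gin_ind: v => [d|v w].
  by rewrite !glift_in // tens_classDl ginD.
rewrite !gliftB // => -> ->.
by rewrite opprD [LHS](AC (2*2) ((1*3)*(2*4))).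
Qed.

Lemma bcompE X Y : bcomp (bmk X) (bmk Y) = bmk (tens X Y).
Proof. by rewrite /bcomp /bmk !glift_in // tens_classE. Qed.

Lemma bcompBl u u' v : bcomp (u - u') v = bcomp u v - bcomp u' v.
Proof. by rewrite /bcomp gliftB. Qed.

Lemma bcompBr u v v' : bcomp u (v - v') = bcomp u v - bcomp u v'.
Proof.
elim/bmk_ind: u => [X|u u' IHu IHu'].
  by rewrite /bcomp /bmk !glift_in // gliftB.
rewrite !bcompBl IHu IHu'.
move: (bcomp u v) (bcomp u v') (bcomp u' v) (bcomp u' v') => a b c d.
by rewrite ![- (_ - d)]opprB [LHS](AC (2*2) ((1*4)*(3*2))).
Qed.

Definition bop_class (c : biset_class G H) : biset_class H G :=
  bcls (bop (brep c)).

Definition bopp (u : burnside G H) : burnside H G :=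
  glift (fun c => gin (bop_class c)) u.

Lemma bop_classE (X : biset G H) : bop_class (bcls X) = bcls (bop X).
Proof. by apply/bclsP; apply: bop_iso; apply: brep_cls. Qed.

Let bop_in : {morph (fun c => gin (bop_class c)) : c c' / c + c'}.
Proof.
elim/bcls_ind=> X; elim/bcls_ind=> Y.
by rewrite -bclsD !bop_classE -ginD -bclsD; congr gin; apply/bclsP/bopD.
Qed.

Lemma boppE X : bopp (bmk X) = bmk (bop X).
Proof. by rewrite /bopp /bmk glift_in // bop_classE. Qed.

Lemma boppB u v : bopp (u - v) = bopp u - bopp v.
Proof. by rewrite /bopp gliftB. Qed.

End Burnside.

Section BurnsideTheory.
Variables G H K L : finGroupType.

Definition bone : burnside G G := bmk (bid G).

Lemma bcompA (u : burnside G H) (v : burnside H K) (w : burnside K L) :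
  bcomp u (bcomp v w) = bcomp (bcomp u v) w.
Proof.
elim/bmk_ind: u => [X|u u' IHu IHu']; last by rewrite !bcompBl IHu IHu'.
elim/bmk_ind: v => [Y|v v' IHv IHv'].
  elim/bmk_ind: w => [Z|w w' IHw IHw']; last by rewrite !bcompBr IHw IHw'.
  by rewrite !bcompE; exact: bmk_iso (tensA X Y Z).
by rewrite bcompBl !bcompBr bcompBl IHv IHv'.
Qed.

Lemma bcomp1l (u : burnside G H) : bcomp bone u = u.
Proof.
elim/bmk_ind: u => [X|u v IHu IHv]; last by rewrite bcompBr IHu IHv.
by rewrite bcompE; apply: bmk_iso (tens1l X).
Qed.

Lemma bcomp1r (u : burnside H G) : bcomp u bone = u.
Proof.
elim/bmk_ind: u => [X|u v IHu IHv]; last by rewrite bcompBl IHu IHv.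
by rewrite bcompE; apply: bmk_iso (tens1r X).
Qed.

Lemma bcompDl (u u' : burnside G H) (v : burnside H K) :
  bcomp (u + u') v = bcomp u v + bcomp u' v.
Proof.
have bN (x : burnside G H) : bcomp (- x) v = - bcomp x v.
  by rewrite -[- x]sub0r bcompBl -[X in bcomp X v](subrr 0) bcompBl subrr sub0r.
by rewrite -[u' in LHS]opprK bcompBl bN opprK.
Qed.

Lemma bcompDr (u : burnside G H) (v v' : burnside H K) :
  bcomp u (v + v') = bcomp u v + bcomp u v'.
Proof.
have bN (x : burnside H K) : bcomp u (- x) = - bcomp u x.
  by rewrite -[- x]sub0r bcompBr -[X in bcomp u X](subrr 0) bcompBr subrr sub0r.
by rewrite -[v' in LHS]opprK bcompBr bN opprK.
Qed.

Lemma bone_neq0 : bone != 0.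
Proof.
apply/eqP => /ginP[c]; rewrite add0r; elim/bcls_ind: c => X.
rewrite -bclsD => /bclsP[f [fB _ _]].
have := bij_eq_card fB; rewrite card_sum => /eqP.
by rewrite -{2}[#|X|]add0n eqn_add2r; apply/negP;
   rewrite -lt0n; apply/card_gt0P; exists 1%g.
Qed.

Lemma boppK : cancel (@bopp G H) (@bopp H G).
Proof.
elim/bmk_ind=> [X|u v IHu IHv]; last by rewrite !boppB IHu IHv.
by rewrite !boppE; apply: bmk_iso (bopK X).
Qed.

Lemma bopp1 : bopp bone = bone.
Proof. by rewrite boppE; apply: bmk_iso (bop1 G). Qed.

Lemma bopp_comp (u : burnside G H) (v : burnside H K) :
  bopp (bcomp u v) = bcomp (bopp v) (bopp u).
Proof.
elim/bmk_ind: u => [X|u u' IHu IHu'].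
  elim/bmk_ind: v => [Y|v v' IHv IHv'].
    by rewrite bcompE !boppE bcompE; apply: bmk_iso (bop_tens X Y).
  by rewrite bcompBr !boppB bcompBl IHv IHv'.
by rewrite bcompBl !boppB bcompBr IHu IHu'.
Qed.

End BurnsideTheory.

HB.instance Definition _ (G : finGroupType) :=
  GRing.Zmodule_isNzRing.Build (burnside G G)
    (@bcompA G G G G) (@bcomp1l G G) (@bcomp1r G G)
    (@bcompDl G G G) (@bcompDr G G G) (bone_neq0 G).

Section UnitRing.
Variable G : finGroupType.
Implicit Types u v : burnside G G.

Definition burnside_unit : pred (burnside G G) :=
  fun u => `[< exists v, v * u = 1 /\ u * v = 1 >].
Definition burnside_inv u : burnside G G :=
  if pselect (exists v, v * u = 1 /\ u * v = 1) is left e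
  then projT1 (cid e) else u.

Fact burnside_mulVr : {in burnside_unit, left_inverse 1 burnside_inv *%R}.
Proof.
move=> u /asboolP e; rewrite /burnside_inv; case: pselect => // e'.
by case: (cid e') => v [].
Qed.

Fact burnside_divrr : {in burnside_unit, right_inverse 1 burnside_inv *%R}.
Proof.
move=> u /asboolP e; rewrite /burnside_inv; case: pselect => // e'.
by case: (cid e') => v [].
Qed.

Fact burnside_unitrP u v : v * u = 1 /\ u * v = 1 -> burnside_unit u.
Proof. by move=> uv; apply/asboolP; exists v. Qed.

Fact burnside_invr_out : {in [predC burnside_unit], burnside_inv =1 id}.
Proof.
by move=> u /asboolP ne; rewrite /burnside_inv; case: pselect.
Qed.

HB.instance Definition _ := GRing.NzRing_hasMulInverse.Build (burnside G G)
  burnside_mulVr burnside_divrr burnside_unitrP burnside_invr_out.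

End UnitRing.

Record unit_group (R : unitRingType) := UnitGroup {
  ug_val :> R;
  ug_valP : ug_val \is a GRing.unit
}.

Section UnitGroup.
Variable R : unitRingType.

HB.instance Definition _ := [isSub for @ug_val R].
HB.instance Definition _ := [Choice of unit_group R by <:].

Definition ug_one : unit_group R := UnitGroup (unitr1 R).

Fact ug_inv_subproof (u : unit_group R) : (val u)^-1 \is a GRing.unit.
Proof. by rewrite unitrV (valP u). Qed.
Definition ug_inv u : unit_group R := UnitGroup (ug_inv_subproof u).

Fact ug_mul_subproof (u v : unit_group R) : val u * val v \is a GRing.unit.
Proof. by rewrite unitrMl (valP u, valP v). Qed.
Definition ug_mul u v : unit_group R := UnitGroup (ug_mul_subproof u v).

Fact ug_mulA : associative ug_mul.
Proof. by move=> u v w; apply: val_inj; rewrite /= mulrA. Qed.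
Fact ug_mul1 : left_id ug_one ug_mul.
Proof. by move=> u; apply: val_inj; rewrite /= mul1r. Qed.
Fact ug_1mul : right_id ug_one ug_mul.
Proof. by move=> u; apply: val_inj; rewrite /= mulr1. Qed.
Fact ug_mulV : left_inverse ug_one ug_inv ug_mul.
Proof. by move=> u; apply: val_inj; rewrite /= mulVr ?(valP u). Qed.
Fact ug_Vmul : right_inverse ug_one ug_inv ug_mul.
Proof. by move=> u; apply: val_inj; rewrite /= divrr ?(valP u). Qed.

HB.instance Definition _ :=
  isGroup.Build (unit_group R) ug_mulA ug_mul1 ug_1mul ug_mulV ug_Vmul.

End UnitGroup.

Section OrthogonalUnits.
Variable G : finGroupType.

Definition orthogonal_unit : {pred unit_group (burnside G G)} :=
  [pred u | (val u * bopp (val u) == 1) && (bopp (val u) * val u == 1)].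

Fact orthogonal_closed : group_closed orthogonal_unit.
Proof.
split=> [|u v].
  by rewrite inE /= [bopp _](bopp1 G) mulr1 eqxx.
rewrite !inE => /andP[/eqP uu /eqP uu'] /andP[/eqP vv /eqP vv'].
have Ev : val (v^-1)%g = bopp (val v).
  by rewrite -[LHS]mulr1 -vv mulrA /= mulVr ?(valP v) // mul1r.
have -> : val (u * v^-1)%g = val u * bopp (val v) by rewrite /= -Ev.
have -> : bopp (val u * bopp (val v)) = val v * bopp (val u).
  by rewrite [LHS]bopp_comp boppK.
apply/andP; split; apply/eqP.
  by rewrite mulrA -(mulrA (val u)) vv' mulr1.
by rewrite mulrA -(mulrA (val v)) uu' mulr1.
Qed.

Record orthogonal_units := OrthogonalUnit {
  ou_val :> unit_group (burnside G G);
  ou_valP : ou_val \in orthogonal_unit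
}.
HB.instance Definition _ := [isSub for ou_val].
HB.instance Definition _ := [Choice of orthogonal_units by <:].
HB.instance Definition _ :=
  SubChoice_isSubGroup.Build _ _ orthogonal_units orthogonal_closed.

End OrthogonalUnits.

(* [subg G] is the type of elements of the group G, as a finGroupType; the
   group G / N is likewise replaced by the type [subg G / N], and quo is the
   canonical projection between them. *)
Section DBInf.
Variables (gT : finGroupType) (G N : {group gT}).
Hypothesis nsNG : (N <| G)%g.

Definition quo (x : [subg G]) : [subg G / N] :=
  subg (G / N)%G (coset N (sgval x)).

Lemma sgval_quo x : sgval (quo x) = coset N (sgval x).
Proof. by rewrite subgK // mem_quotient // subgP. Qed.

Lemma quoM : {morph quo : x y / x * y}%g.
Proof.
move=> x y; apply: val_inj; rewrite /= !sgval_quo /=.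
by rewrite morphM //; apply: (subsetP (normal_norm nsNG)); apply: subgP.
Qed.

Lemma quo1 : quo 1%g = 1%g.
Proof. by apply: (mulgI (quo 1%g)); rewrite -quoM !mulg1. Qed.

Lemma quo_surj y : exists x, quo x = y.
Proof.
have /morphimP[x Nx Gx e] := subgP y.
by exists (subg G x); apply: val_inj; rewrite /= sgval_quo subgK.
Qed.

Definition inf_on : biset_on [subg G] [subg G / N] [subg G / N].
Proof.
exists (fun g a => quo g * a)%g (fun a b => a * b)%g.
- by move=> a; rewrite quo1 mul1g.
- by move=> g g' a; rewrite quoM mulgA.
- exact: mulg1.
- by move=> a b b'; rewrite mulgA.
- by move=> g a b; rewrite mulgA.
Defined.

Definition def_on : biset_on [subg G / N] [subg G] [subg G / N].
Proof.
exists (fun b a => b * a)%g (fun a g => a * quo g)%g.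
- exact: mul1g.
- by move=> b b' a; rewrite mulgA.
- by move=> a; rewrite quo1 mulg1.
- by move=> a g g'; rewrite quoM mulgA.
- by move=> b a g; rewrite mulgA.
Defined.

Definition Inf : burnside [subg G] [subg G / N] := bmk (Biset inf_on).
Definition Def : burnside [subg G / N] [subg G] := bmk (Biset def_on).

Lemma Def_Inf : bcomp Def Inf = 1.
Proof.
rewrite bcompE; apply: bmk_iso.
apply: (@tens_isoI _ _ _ (Biset def_on) (Biset inf_on) (bid _)
  (fun a b : [subg G / N] => a * b)%g).
- by move=> a g b /=; rewrite mulgA.
- move=> a b a' b' e; apply/tclP; have [g gE] := quo_surj (a'^-1 * a)%g.
  have gVE : quo g^-1%g = (a^-1 * a')%g.
    apply: (mulgI (quo g)); rewrite -quoM mulgV quo1 gE.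
    by rewrite mulgA mulgK mulVg.
  exists g; rewrite /= gVE gE mulKVg; split=> //.
  by rewrite -mulgA e mulKg.
- by move=> c; exists c, 1%g; rewrite mulg1.
- by move=> g a b; rewrite /= mulgA.
- by move=> a b k; rewrite /= mulgA.
Qed.

Definition dBInf_fun (u : burnside [subg G / N] [subg G / N]) :
    burnside [subg G] [subg G] :=
  1 + bcomp (bcomp Inf (u - 1)) Def.

Lemma dBInf_fun1 : dBInf_fun 1 = 1.
Proof.
rewrite /dBInf_fun subrr -(subrr 1) bcompBr bcompBl.
by rewrite (subrr (bcomp _ _)) addr0.
Qed.

Lemma dBInf_funM : {morph dBInf_fun : u v / u * v}.
Proof.
move=> u v; pose I x := bcomp (bcomp Inf x) Def.
have IM x y : I x * I y = I (x * y).
  rewrite /I [LHS]bcompA -[bcomp (bcomp _ Def) _]bcompA.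
  rewrite [bcomp Def (bcomp _ _)]bcompA Def_Inf.
  by rewrite [bcomp 1 y]bcomp1l -[bcomp (bcomp Inf x) y]bcompA.
have ID x y : I (x + y) = I x + I y by rewrite /I bcompDr bcompDl.
rewrite /dBInf_fun -!/(I _) mulrDl mul1r mulrDr mulr1 IM -addrA; congr (1 + _).
rewrite -!ID; congr (I _).
rewrite -{1}[u - 1]mulr1 -mulrDr [1 + _]addrC subrK mulrBl mul1r.
by rewrite [RHS]addrC addrA subrK.
Qed.

Fact dBInf_subproof (u : unit_group (burnside [subg G / N] [subg G / N])) :
  dBInf_fun (val u) \is a GRing.unit.
Proof.
apply/unitrP; exists (dBInf_fun (val u)^-1); rewrite -!dBInf_funM.
by rewrite mulVr ?mulrV ?(valP u) // dBInf_fun1.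
Qed.

Definition dBInf (u : unit_group (burnside [subg G / N] [subg G / N])) :
  unit_group (burnside [subg G] [subg G]) := UnitGroup (dBInf_subproof u).

Fact dBInfM : {morph dBInf : u v / (u * v)%g}.
Proof. by move=> u v; apply: val_inj; rewrite /= dBInf_funM. Qed.

HB.instance Definition _ := isMultiplicative.Build _ _ dBInf dBInfM.

End DBInf.

(* Main.v *)
From HB Require Import structures.
Require Import Defs.
From mathcomp Require Import all_boot all_order all_fingroup all_algebra.

Set Implicit Arguments.
Unset Strict Implicit.
Unset Printing Implicit Defensive.

Import GRing.Theory.
Local Open Scope ring_scope.

(** Inflation and deflation are opposite to each other: inversion on G / N
    exchanges the two actions ([bopp_Inf], [bopp_Def]).  Since the opposite
    reverses products, the opposite of Inf o (u - 1) o Def is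
    Inf o (u^o - 1) o Def, so dBInf commutes with the opposite
    ([bopp_dBInf_fun]).  As dBInf is multiplicative and sends 1 to 1, it carries
    the equations u u^o = u^o u = 1 to the same equations for its image
    ([dBInf_orthogonal]).  The restricted map is multiplicative because
    the orthogonal units embed as a subgroup of all units. *)

Lemma boppD (G H : finGroupType) (u v : burnside G H) :
  bopp (u + v) = bopp u + bopp v.
Proof.
have boppN (w : burnside G H) : bopp (- w) = - bopp w.
  by rewrite -[- w]sub0r boppB -[X in bopp X](subrr 0) boppB subrr sub0r.
by rewrite -[v in LHS]opprK boppB boppN opprK.
Qed.

Section OppositeOfDBInf.
Variables (gT : finGroupType) (G N : {group gT}).
Hypothesis nsNG : (N <| G)%g.

Lemma quoV (x : [subg G]) : quo N x^-1%g = (quo N x)^-1%g.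
Proof.
by apply: (mulgI (quo N x)); rewrite -(quoM nsNG) !mulgV (quo1 nsNG).
Qed.

(** The two bisets share the carrier G / N, but the opposite lets each group
    act from the other side through inverses; a |-> a^-1 undoes this. *)
Lemma bopp_Inf : bopp (Inf nsNG) = Def nsNG.
Proof.
rewrite boppE; apply: bmk_iso.
exists (fun a : [subg G / N] => a^-1)%g; split=> [|b a|a g] /=.
- by exists (fun a : [subg G / N] => a^-1)%g => a; rewrite invgK.
- by rewrite invMg invgK.
- by rewrite quoV invMg invgK.
Qed.

Lemma bopp_Def : bopp (Def nsNG) = Inf nsNG.
Proof. by rewrite -bopp_Inf boppK. Qed.

Lemma bopp_dBInf_fun (u : burnside [subg G / N] [subg G / N]) :
  bopp (dBInf_fun nsNG u) = dBInf_fun nsNG (bopp u).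
Proof.
rewrite /dBInf_fun boppD [bopp 1]bopp1 !bopp_comp boppB [bopp 1]bopp1.
by rewrite bopp_Inf bopp_Def bcompA.
Qed.

Lemma dBInf_orthogonal (u : unit_group (burnside [subg G / N] [subg G / N])) :
  u \in @orthogonal_unit _ -> dBInf nsNG u \in @orthogonal_unit _.
Proof.
rewrite !inE /= => /andP[/eqP uuo /eqP uou].
by rewrite bopp_dBInf_fun -!dBInf_funM uuo uou dBInf_fun1 eqxx.
Qed.

Definition dBInf_ou (u : orthogonal_units [subg G / N]) :
  orthogonal_units [subg G] := OrthogonalUnit (dBInf_orthogonal (valP u)).

Fact dBInf_ouM : {morph dBInf_ou : u v / (u * v)%g}.
Proof. by move=> u v; apply: val_inj; rewrite /= !gmulfM. Qed.

HB.instance Definition _ := isMultiplicative.Build _ _ dBInf_ou dBInf_ouM.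

End OppositeOfDBInf.

Theorem proposition4p3 (gT : finGroupType) (G N : {group gT})
    (nsNG : (N <| G)%g) :
  exists f : {multiplicative orthogonal_units [subg G / N] ->
                             orthogonal_units [subg G]},
    forall u : orthogonal_units [subg G / N], f u = dBInf nsNG u :> unit_group (burnside [subg G] [subg G]).
Proof. by exists (dBInf_ou nsNG). Qed.
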